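(* Let $A$ be a commutative ring, $n\geq 1$, and let $\phi:\mathcal L^n(A)\to\mathcal L^n(A)$ be a continuous homomorphism of $A$-algebras. Put $\varphi_i=\phi(t_i)$ for $1\leq i\leq n$, $\varphi=(\varphi_1,\ldots,\varphi_n)$, and let $J(\varphi)=\det\left(\frac{\partial\varphi_i}{\partial t_j}\right)\in\mathcal L^n(A)$ be the Jacobian. Then for any $f\in\mathcal L^n(A)$, there is an equality $$\phi^{\vee}(f)=\sum_{l\in\mathbb Z^n}\mathrm{res}\big(f\varphi^{-l-1}J(\varphi)\,dt_1\wedge\ldots\wedge dt_n\big)\,t^l,$$ where $\varphi^{-l-1}=\varphi_1^{-l_1-1}\cdots\varphi_n^{-l_n-1}$ for $l=(l_1,\ldots,l_n)$.
   Context: Rings are commutative, associative and unital. For $n\geq 1$, $\mathcal L^n(A)=A((t_1))\ldots((t_n))$ is the ring of iterated Laurent series (inductively $\mathcal L^1(A)=A((t_1))$, $\mathcal L^n(A)=\mathcal L^{n-1}(A)((t_n))$). Elements are written $f=\sum_{l\in\mathbb Z^n}a_lt^l$ with $t^l=t_1^{l_1}\cdots t_n^{l_n}$, and $\mathrm{supp}(f)=\{l: a_l\neq 0\}$. Put $\Lambda_1=\mathbb Z$, $\mathbb Z^1_\lambda=\{l\in\mathbb Z: l\geq\lambda\}$, and for $n\geq 2$ put $\Lambda_n=\mathrm{Map}(\mathbb Z,\Lambda_{n-1})\times\mathbb Z$ and $\mathbb Z^n_\lambda=\bigcup_{l_n\geq\lambda_n}\mathbb Z^{n-1}_{\lambda'(l_n)}\times\{l_n\}$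 for $\lambda=(\lambda',\lambda_n)\in\Lambda_n$. A formal series lies in $\mathcal L^n(A)$ iff its support is contained in $\mathbb Z^n_\lambda$ for some $\lambda\in\Lambda_n$. Topology: $\mathcal L^n(A)$ is an additive topological group with a base of open neighborhoods of zero given by the $A$-submodules $U_\lambda=\{f:\mathrm{supp}(f)\cap(-\mathbb Z^n_\lambda)=\varnothing\}$, $\lambda\in\Lambda_n$. $\widetilde\Omega^1_{\mathcal L^n(A)}$ is the quotient of the module of absolute Kähler differentials of $\mathcal L^n(A)$ by the $\mathcal L^n(A)$-submodule generated by all $df-\sum_{i=1}^n\frac{\partial f}{\partial t_i}dt_i$; it is free with basis $dt_1,\ldots,dt_n$. $\widetilde\Omega^n_{\mathcal L^n(A)}=\bigwedge^n\widetilde\Omega^1_{\mathcal L^n(A)}\simeq\mathcal L^n(A)\,dt_1\wedge\ldots\wedge dt_n$, and $\mathrm{res}:\widetilde\Omega^n_{\mathcal L^n(A)}\to A$ is $\sum_l a_lt^l\,dt_1\wedge\ldots\wedge dt_n\mapsto a_{-1\ldots-1}$. $\phi$ also denotes the induced map on $\widetilde\Omega^n_{\mathcal L^n(A)}$, $f\,dt_1\wedge\ldots\wedge dt_n\mapsto\phi(f)\,d\phi(t_1)\wedge\ldots\wedge d\phi(t_n)$. The pairing $(f,\omega)\mapsto\mathrm{res}(f\omega)$ identifies $\mathcal L^n(A)$ with the $A$-module of continuous $A$-linear maps $\widetilde\Omega^n_{\mathcal L^n(A)}\to A$ ($A$ discrete), and $\phi^\vee:\mathcal L^n(A)\to\mathcal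 L^n(A)$ is the continuous $A$-linear map adjoint to $\phi:\widetilde\Omega^n_{\mathcal L^n(A)}\to\widetilde\Omega^n_{\mathcal L^n(A)}$: it is uniquely determined by $\mathrm{res}(\phi^\vee(f)\,\omega)=\mathrm{res}(f\,\phi(\omega))$ for all $f\in\mathcal L^n(A)$, $\omega\in\widetilde\Omega^n_{\mathcal L^n(A)}$. *)

(* Defs.v *)
From HB Require Import structures.
From mathcomp Require Import all_boot all_order all_algebra.
From mathcomp Require Import generic_quotient ring_quotient zify.
From mathcomp Require Import mathcomp_extra boolp classical_sets functions.
From mathcomp Require Import cardinality fsbigop filter topology.

(* All rings are comPzRingType, so that the zero ring is allowed.  This rules
   out the library's unitRingType and lalgType, which require 1 != 0: inverses,
   and A-algebra morphisms as A-linear ring morphisms, are handled by hand. *)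

Set Implicit Arguments.
Unset Strict Implicit.
Unset Printing Implicit Defensive.
Import Order.TTheory GRing.Theory Num.Theory.
Local Open Scope classical_set_scope.
Local Open Scope ring_scope.

Section Laurent.
Variable B : comPzRingType.

Definition bounded_below : {pred int -> B} :=
  fun f => `[< exists N : int, forall k, k < N -> f k = 0 >].

Fact bounded_below_zmod : zmod_closed bounded_below.
Proof.
split=> [|f g /asboolP[N fN] /asboolP[M gM]]; apply/asboolP; first by exists 0.
exists (Num.min N M) => k; rewrite lt_min => /andP[kN kM].
have -> : (f - g) k = f k - g k by [].
by rewrite fN // gM // subr0.
Qed.
HB.instance Definition _ :=
  GRing.isZmodClosed.Build (int -> B) bounded_below bounded_below_zmod.

Definition laurent := {f : int -> B | f \in bounded_below}.
Definition mkLaurent (f : int -> B) (fb : f \in bounded_below) : laurent :=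
  exist (fun u => u \in bounded_below) f fb.
HB.instance Definition _ := [isSub of laurent for @sval _ _].
HB.instance Definition _ := [Choice of laurent by <:].
HB.instance Definition _ := [SubChoice_isSubZmodule of laurent by <:].

Implicit Types f g h : laurent.

Lemma laurent_bound f : exists N : int, forall k, k < N -> val f k = 0.
Proof. exact/asboolP/(valP f). Qed.

Lemma laurentP f g : (forall k, val f k = val g k) -> f = g.
Proof. by move=> fg; apply/val_inj/funext. Qed.

Lemma laurentDE f g k : val (f + g) k = val f k + val g k.
Proof. by []. Qed.

Lemma finite_itvz (a b : int) : finite_set [set i : int | a <= i <= b].
Proof.
pose s := [seq a + j%:Z | j <- iota 0 `|b - a|.+1].
apply: (@sub_finite_set _ _ [set` s]); last exact: finite_seq.
move=> i /= /andP[ai ib]; apply/mapP; exists `|i - a|%N; last lia.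
by rewrite mem_iota; lia.
Qed.

(* For f and g bounded below, only finitely many i contribute; outside of that
   case the library's \sum_(i \in _) is 0 by convention. *)
Definition lmul_fun (f g : int -> B) (k : int) : B :=
  \sum_(i \in [set: int]) f i * g (k - i).

Lemma lmul_funE (f g : int -> B) N M k (a b : int) :
  (forall k, k < N -> f k = 0) -> (forall k, k < M -> g k = 0) ->
  a <= N -> k - M <= b ->
  lmul_fun f g k = \sum_(i \in [set i : int | a <= i <= b]) f i * g (k - i).
Proof.
move=> fN gM aN kMb; rewrite /lmul_fun; apply/esym/fsbig_widen => // i /= [_ H].
have [iN|iN] := ltP i N; first by rewrite fN // mul0r.
by rewrite gM ?mulr0 //; apply: contra_notT H; rewrite -leNgt; lia.
Qed.

Lemma lmul_fun_bound (f g : int -> B) N M :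
  (forall k, k < N -> f k = 0) -> (forall k, k < M -> g k = 0) ->
  forall k, k < N + M -> lmul_fun f g k = 0.
Proof.
move=> fN gM k kNM; rewrite /lmul_fun fsbig1 // => i _.
have [iN|iN] := ltP i N; first by rewrite fN // mul0r.
by rewrite gM ?mulr0 //; lia.
Qed.

Fact lmul_subproof f g : lmul_fun (val f) (val g) \in bounded_below.
Proof.
have [[N fN] [M gM]] := (laurent_bound f, laurent_bound g).
by apply/asboolP; exists (N + M); exact: lmul_fun_bound.
Qed.
Definition lmul f g : laurent := mkLaurent (lmul_subproof f g).

Definition single_fun (j : int) (b : B) (k : int) : B := if k == j then b else 0.
Fact single_subproof j b : single_fun j b \in bounded_below.
Proof.
by apply/asboolP; exists j => k kj; rewrite /single_fun lt_eqF.
Qed.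
Definition single j b : laurent := mkLaurent (single_subproof j b).

Fact lmulC : commutative lmul.
Proof.
move=> f g; apply: laurentP => k /=; rewrite /lmul_fun.
rewrite (@reindex_fsbigT _ _ _ _ _ (fun i => k - i)) /=; last first.
  by exists (fun i => k - i) => i; lia.
by apply: eq_fsbigr => i _; rewrite mulrC; congr (val g _ * _); lia.
Qed.

Fact lmulA : associative lmul.
Proof.
move=> f g h; apply: laurentP => k /=.
have [[N fN] [M gM]] := (laurent_bound f, laurent_bound g).
have [P hP] := laurent_bound h.
pose J := [set i : int | N <= i <= k - M - P].
pose I := [set i : int | N + M <= i <= k - P].
have fJ : finite_set J by exact: finite_itvz.
have fI : finite_set I by exact: finite_itvz.
have ghB := lmul_fun_bound gM hP; have fgB := lmul_fun_bound fN gM.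
rewrite (@lmul_funE _ _ N (M + P) k N (k - M - P)) //; last lia.
rewrite [RHS](@lmul_funE _ _ (N + M) P k (N + M) (k - P)) //.
rewrite -/I -/J.
transitivity (\sum_(j \in J) \sum_(i \in I)
    val f j * val g (i - j) * val h (k - i)).
  apply: eq_fsbigr => j /set_mem /= /andP[Nj _].
  transitivity (val f j * \sum_(i \in I) val g (i - j) * val h (k - i)).
    congr (_ * _); rewrite /lmul_fun.
    rewrite (@reindex_fsbigT _ _ _ _ _ (fun i => i - j)) /=; last first.
      by exists (fun i => i + j) => i; lia.
    transitivity (\sum_(i \in [set: int]) val g (i - j) * val h (k - i)).
      by apply: eq_fsbigr => i _; congr (_ * val h _); lia.
    apply/esym/fsbig_widen => // i /= [_ H].
    have [iN|iN] := ltP (i - j) M; first by rewrite gM // mul0r.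
    by rewrite hP ?mulr0 //; apply: contra_notT H; rewrite -leNgt /I /= => H; lia.
  rewrite !fsbig_finite //= big_distrr /=.
  by apply: eq_bigr => i _; rewrite mulrA.
rewrite exchange_fsbig //; apply: eq_fsbigr => i /set_mem /= /andP[_ iP].
rewrite (@lmul_funE _ _ N M i N (k - M - P)) //; last lia.
by rewrite !fsbig_finite //= big_distrl.
Qed.

Fact lmul1 : left_id (single 0 1) lmul.
Proof.
move=> f; apply: laurentP => k /=; rewrite /lmul_fun.
rewrite -(fsbig_widen [set 0]) ?fsbig_set1 //=.
  by rewrite /single_fun eqxx mul1r subr0.
by move=> i /= [_ /eqP i0]; rewrite /single_fun (negPf i0) mul0r.
Qed.

Fact lmulDl : left_distributive lmul +%R.
Proof.
move=> f1 f2 g; apply: laurentP => k.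
have [[N fN] [M gM]] := (laurent_bound f1, laurent_bound g).
have [N' fN'] := laurent_bound f2.
pose Q := Num.min N N'.
have QN : Q <= N by rewrite ge_min lexx.
have QN' : Q <= N' by rewrite ge_min lexx orbT.
have f12Q i : i < Q -> val (f1 + f2) i = 0.
  by rewrite laurentDE lt_min => /andP[/fN-> /fN'->]; rewrite addr0.
rewrite laurentDE /= (lmul_funE f12Q gM (lexx _) (lexx _)).
rewrite (lmul_funE fN gM QN (lexx _)) (lmul_funE fN' gM QN' (lexx _)).
rewrite -fsbig_split /=; last exact: finite_itvz.
by apply: eq_fsbigr => i _; rewrite -mulrDl.
Qed.

HB.instance Definition _ :=
  GRing.Zmodule_isComPzRing.Build laurent lmulA lmulC lmul1 lmulDl.

Definition laurentX : laurent := single 1 1.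
Definition laurentC (b : B) : laurent := single 0 b.

Fact laurentC_additive : zmod_morphism laurentC.
Proof.
move=> a b; apply: laurentP => k.
have -> : val (laurentC a - laurentC b) k
        = val (laurentC a) k - val (laurentC b) k by [].
by rewrite /= /single_fun; case: ifP => // _; rewrite subr0.
Qed.
Fact laurentC_monoid : monoid_morphism laurentC.
Proof.
split=> // a b; apply: laurentP => k /=.
rewrite [RHS]/(lmul_fun _ _ _) /lmul_fun.
rewrite -(fsbig_widen [set 0]) ?fsbig_set1 //=.
  by rewrite /single_fun eqxx subr0; case: ifP; rewrite ?mulr0.
by move=> i /= [_ /eqP i0]; rewrite /single_fun (negPf i0) mul0r.
Qed.
HB.instance Definition _ :=
  GRing.isZmodMorphism.Build B laurent laurentC laurentC_additive.
HB.instance Definition _ :=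
  GRing.isMonoidMorphism.Build B laurent laurentC laurentC_monoid.

Definition lderiv_fun (f : int -> B) (k : int) : B := f (k + 1) *~ (k + 1).
Fact lderiv_subproof f : lderiv_fun (val f) \in bounded_below.
Proof.
have [N fN] := laurent_bound f; apply/asboolP; exists (N - 1) => k kN.
by rewrite /lderiv_fun fN ?mul0rz //; lia.
Qed.
Definition lderiv f : laurent := mkLaurent (lderiv_subproof f).
Fact lderiv_additive : zmod_morphism lderiv.
Proof. by move=> f g; apply: laurentP => k; exact: mulrzBl. Qed.
HB.instance Definition _ :=
  GRing.isZmodMorphism.Build laurent laurent lderiv lderiv_additive.

End Laurent.

Section LaurentMap.
Variables (B C : comPzRingType) (h : {additive B -> C}).
Fact lmap_subproof (f : laurent B) : h \o val f \in @bounded_below C.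
Proof.
have [N fN] := laurent_bound f; apply/asboolP; exists N => k kN /=.
by rewrite fN // raddf0.
Qed.
Definition lmap (f : laurent B) : laurent C := mkLaurent (lmap_subproof f).
Fact lmap_additive : zmod_morphism lmap.
Proof. by move=> f g; apply: laurentP => k; exact: (raddfB h). Qed.
HB.instance Definition _ :=
  GRing.isZmodMorphism.Build (laurent B) (laurent C) lmap lmap_additive.
End LaurentMap.

Section IteratedLaurent.
Variable A : comPzRingType.

(* L^n(A) = A((t_1))...((t_n)), with L^0(A) = A.  The last index
   ord_max : 'I_m.+1 is that of the outermost variable, and lift ord_max embeds
   'I_m as the first m indices. *)
Fixpoint iterL_rec (n : nat) : comPzRingType :=
  if n is m.+1 then laurent (iterL_rec m) else A.
Definition iterL (n : nat) : Type := iterL_rec n.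
HB.instance Definition _ n := GRing.ComPzRing.on (iterL n).

(* The A-algebra structure map A -> L^n(A) *)
Fixpoint iterC (n : nat) : {rmorphism A -> iterL_rec n} :=
  match n with
  | 0 => idfun
  | m.+1 => @laurentC (iterL_rec m) \o iterC m
  end.

Definition scaleL n (a : A) (f : iterL n) : iterL n := iterC n a * f.
Fact scaleLA n a b (f : iterL n) : scaleL a (scaleL b f) = scaleL (a * b) f.
Proof. by rewrite /scaleL rmorphM mulrA. Qed.
Fact scaleL1 n : left_id 1 (@scaleL n).
Proof. by move=> f; rewrite /scaleL rmorph1 mul1r. Qed.
Fact scaleLDr n : right_distributive (@scaleL n) +%R.
Proof. by move=> a f g; rewrite /scaleL mulrDr. Qed.
Fact scaleLDl n f : {morph (@scaleL n)^~ f : a b / a + b}.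
Proof. by move=> a b; rewrite /scaleL rmorphD mulrDl. Qed.
HB.instance Definition _ n := GRing.Zmodule_isLmodule.Build A (iterL n)
  (@scaleLA n) (@scaleL1 n) (@scaleLDr n) (@scaleLDl n).

Fixpoint tvar (n : nat) : 'I_n -> iterL n :=
  match n with
  | 0 => fun=> 0
  | m.+1 => fun i => if unlift ord_max i is Some j
                     then laurentC (tvar j) else laurentX (iterL_rec m)
  end.

Fixpoint pderiv_rec (n : nat) : 'I_n -> {additive iterL_rec n -> iterL_rec n} :=
  match n with
  | 0 => fun=> \0
  | m.+1 => fun i => if unlift ord_max i is Some j
                     then lmap (pderiv_rec j) else @lderiv (iterL_rec m)
  end.
Definition pderiv n (i : 'I_n) (f : iterL n) : iterL n := pderiv_rec i f.

(* coef f l is the coefficient a_l of f = \sum_l a_l t^l. *)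
Fixpoint coef (n : nat) : iterL n -> ('I_n -> int) -> A :=
  match n with
  | 0 => fun f _ => f
  | m.+1 => fun f l => @coef m (val f (l ord_max)) (l \o lift ord_max)
  end.

Definition supp n (f : iterL n) : set ('I_n -> int) :=
  [set l | coef f l <> 0].

Definition has_expansion n (f : iterL n) (a : ('I_n -> int) -> A) : Prop :=
  forall l, coef f l = a l.

(* Lambda 0 is a point and Zlambda is everything for n = 0; hence
   Lambda 1 = Map(Z, pt) x Z stands for Z, and Zlambda is {l >= lam} for n = 1. *)
Fixpoint Lambda (n : nat) : Type :=
  if n is m.+1 then ((int -> Lambda m) * int)%type else unit.

Fixpoint Zlambda (n : nat) : Lambda n -> set ('I_n -> int) :=
  match n with
  | 0 => fun=> setT
  | m.+1 => fun lam => [set l | lam.2 <= l ord_max /\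
                          @Zlambda m (lam.1 (l ord_max)) (l \o lift ord_max)]
  end.

Definition Ulambda n (lam : Lambda n) : set (iterL n) :=
  [set f | supp f `&` (-%R @` Zlambda lam) = set0].

Lemma coefB n (f g : iterL n) l : coef (f - g) l = coef f l - coef g l.
Proof. by elim: n f g l => [//|n IH] f g l /=; rewrite -IH. Qed.

Lemma UlambdaP n (lam : Lambda n) f :
  Ulambda lam f <-> forall l, Zlambda lam l -> coef f (- l) = 0.
Proof.
split=> [Uf l lamP|Uf].
  by apply: contrapT => fl; have : set0 (- l) by rewrite -Uf; split=> //; exists l.
by apply/seteqP; split=> // x [fx [l lamP lx]]; apply: fx; rewrite -lx; exact: Uf.
Qed.

Fact Ulambda0 n (lam : Lambda n) : Ulambda lam 0.
Proof. by apply/UlambdaP => l _; rewrite -(subrr 0) coefB subrr. Qed.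

Fact UlambdaB n (lam : Lambda n) f g :
  Ulambda lam f -> Ulambda lam g -> Ulambda lam (f - g).
Proof.
move=> /UlambdaP Uf /UlambdaP Ug; apply/UlambdaP => l lamP.
by rewrite coefB Uf // Ug // subrr.
Qed.

Fixpoint lambda0 n : Lambda n :=
  match n with 0 => tt | m.+1 => (fun=> lambda0 m, 0) end.

Fixpoint joinL n : Lambda n -> Lambda n -> Lambda n :=
  match n with
  | 0 => fun _ _ => tt
  | m.+1 => fun lam mu => (fun k => @joinL m (lam.1 k) (mu.1 k),
                           Num.min lam.2 mu.2)
  end.

Lemma joinLP n (lam mu : Lambda n) l :
  Zlambda lam l \/ Zlambda mu l -> Zlambda (joinL lam mu) l.
Proof.
elim: n lam mu l => [//|n IH] lam mu l /= H; split.
  by rewrite ge_min; case: H => -[-> _]; rewrite ?orbT.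
by apply: IH; case: H => -[_ H]; [left|right].
Qed.

Lemma Ulambda_join n (lam mu : Lambda n) :
  Ulambda (joinL lam mu) `<=` Ulambda lam `&` Ulambda mu.
Proof.
move=> f /UlambdaP Uf; split; apply/UlambdaP => l lP; apply: Uf; apply: joinLP.
  by left.
by right.
Qed.

(* The sets f + U_lambda form a base of neighborhoods of f. *)
Definition nbhsL n (f : iterL n) : set_system (iterL n) :=
  filter_from [set: Lambda n] (fun lam => [set g | Ulambda lam (g - f)]).
HB.instance Definition _ n := hasNbhs.Build (iterL n) (@nbhsL n).

Fact nbhsL_filter n (f : iterL n) : ProperFilter (nbhsL f).
Proof.
apply: filter_from_proper; last first.
  by move=> lam _; exists f; rewrite /= subrr; exact: Ulambda0.
apply: filter_from_filter; first by exists (lambda0 n).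
by move=> lam mu _ _; exists (joinL lam mu) => // g /Ulambda_join.
Qed.
Fact nbhsL_singleton n (f : iterL n) (V : set (iterL n)) : nbhsL f V -> V f.
Proof.
by move=> [lam _]; apply; rewrite /= subrr; exact: Ulambda0.
Qed.
Fact nbhsL_nbhsL n (f : iterL n) (V : set (iterL n)) :
  nbhsL f V -> nbhsL f (@nbhsL n ^~ V).
Proof.
move=> [lam _ lamV]; exists lam => // g /= gf; exists lam => // h /= hg.
apply: lamV => /=; have -> : h - f = (h - g) - (0 - (g - f)).
  by rewrite sub0r opprK addrA subrK.
by apply: UlambdaB => //; apply: UlambdaB => //; exact: Ulambda0.
Qed.
HB.instance Definition _ n := Nbhs_isNbhsTopological.Build (iterL n)
  (@nbhsL_filter n) (@nbhsL_singleton n) (@nbhsL_nbhsL n).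

End IteratedLaurent.

Section IntegerPower.
Variable R : comPzRingType.
Definition ring_inv (x : R) : R := xget 0 [set y | x * y = 1].
Definition zexp (x : R) (k : int) : R :=
  match k with Posz m => x ^+ m | Negz m => ring_inv x ^+ m.+1 end.
End IntegerPower.

(* The quotient of V by the submodule generated by G. *)
Section QuotientModule.
Variables (R : pzRingType) (V : lmodType R).

Definition submodule_gen (G : set V) : {pred V} :=
  fun v => `[< forall S : {pred V}, submod_closed S ->
                 (forall g, G g -> g \in S) -> v \in S >].

Variable G : set V.

Fact submodule_gen_closed : submod_closed (submodule_gen G).
Proof.
split=> [|a u v /asboolP Gu /asboolP Gv]; apply/asboolP.
  by move=> S [].
move=> S Sclosed GS; case: (Sclosed) => _; apply; first exact: Gu.
exact: Gv.
Qed.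
HB.instance Definition _ := GRing.isSubmodClosed.Build R V (submodule_gen G)
  (GRing.submod_closed_semi submodule_gen_closed).

Definition quotmod : Type := {ideal_quot (submodule_gen G)}.
HB.instance Definition _ := GRing.Zmodule.on quotmod.
Definition quotmod_pi (v : V) : quotmod := (\pi_{ideal_quot (submodule_gen G)} v)%qT.

Lemma quotmod_piB u v : quotmod_pi (u - v) = quotmod_pi u - quotmod_pi v.
Proof. exact: (raddfB (\pi_{ideal_quot (submodule_gen G)})%qT). Qed.

Lemma quotmod_eq u v : quotmod_pi u = quotmod_pi v <-> u - v \in submodule_gen G.
Proof. by rewrite Quotient.idealrBE; split=> [uv|/eqP]; first exact/eqP. Qed.

Lemma quotmod_surj (x : quotmod) : exists v, quotmod_pi v = x.
Proof. by exists (repr (x : {ideal_quot (submodule_gen G)})); exact: reprK. Qed.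

Definition quotmod_scale (a : R) (x : quotmod) : quotmod :=
  quotmod_pi (a *: repr (x : {ideal_quot (submodule_gen G)})).

Lemma quotmod_scaleE a v : quotmod_scale a (quotmod_pi v) = quotmod_pi (a *: v).
Proof.
apply/quotmod_eq; rewrite -scalerBr rpredZ //.
by apply/quotmod_eq; exact: reprK.
Qed.

Fact quotmod_scaleA a b x :
  quotmod_scale a (quotmod_scale b x) = quotmod_scale (a * b) x.
Proof. by have [v <-] := quotmod_surj x; rewrite !quotmod_scaleE scalerA. Qed.
Fact quotmod_scale1 : left_id 1 quotmod_scale.
Proof.
by move=> x; have [v <-] := quotmod_surj x; rewrite quotmod_scaleE scale1r.
Qed.
Lemma quotmod_piD u v : quotmod_pi (u + v) = quotmod_pi u + quotmod_pi v.
Proof. exact: (raddfD (\pi_{ideal_quot (submodule_gen G)})%qT). Qed.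
Fact quotmod_scaleDr : right_distributive quotmod_scale +%R.
Proof.
move=> a x y; have [[u <-] [v <-]] := (quotmod_surj x, quotmod_surj y).
by rewrite -quotmod_piD !quotmod_scaleE scalerDr quotmod_piD.
Qed.
Fact quotmod_scaleDl x : {morph quotmod_scale^~ x : a b / a + b}.
Proof.
move=> a b; have [v <-] := quotmod_surj x.
by rewrite !quotmod_scaleE scalerDl quotmod_piD.
Qed.
HB.instance Definition _ := GRing.Zmodule_isLmodule.Build R quotmod
  quotmod_scaleA quotmod_scale1 quotmod_scaleDr quotmod_scaleDl.

End QuotientModule.

(* The free R-module on X: finitely supported functions from X to R. *)
Section FreeModule.
Variables (R : pzRingType) (X : choiceType).

Definition finite_support : {pred X -> R^o} :=
  fun u => `[< finite_set [set x | u x <> 0] >].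

Fact finite_support_closed : subsemimod_closed finite_support.
Proof.
apply: GRing.submod_closed_semi.
split=> [|a u v /asboolP fu /asboolP fv]; apply/asboolP.
  by apply: (sub_finite_set _ (finite_set0 X)) => x /=.
have fuv : finite_set ([set x | u x <> 0] `|` [set x | v x <> 0]).
  by rewrite finite_setU.
apply: (sub_finite_set _ fuv) => x /= H.
have [u0|] := pselect (u x = 0); last by left.
right=> v0; apply: H.
have -> : (a *: u + v) x = a *: u x + v x by [].
by rewrite u0 v0 scaler0 addr0.
Qed.
HB.instance Definition _ :=
  GRing.isSubmodClosed.Build R (X -> R^o) finite_support finite_support_closed.

Definition freemod := {u : X -> R^o | u \in finite_support}.
HB.instance Definition _ := [isSub of freemod for @sval _ _].
HB.instance Definition _ := [Choice of freemod by <:].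
HB.instance Definition _ := [SubChoice_isSubLmodule of freemod by <:].

Fact fgen_subproof (x : X) :
  (fun y => (y == x)%:R : R^o) \in finite_support.
Proof.
apply/asboolP; apply: (sub_finite_set _ (finite_set1 x)) => y /=.
by case: eqP => [->//|_ /(_ erefl)].
Qed.
Definition fgen (x : X) : freemod :=
  exist (fun u => u \in finite_support) _ (fgen_subproof x).

End FreeModule.

(* The module of absolute Kaehler differentials of K. *)
Section Kaehler.
Variable K : comPzRingType.

Definition kaehler_rel : set (freemod K K) :=
  [set r | exists f g : K,
     r = fgen K (f + g) - fgen K f - fgen K g \/
     r = fgen K (f * g) - f *: fgen K g - g *: fgen K f].

Definition kaehler : Type := quotmod kaehler_rel.
HB.instance Definition _ := GRing.Lmodule.on kaehler.
Definition kaehler_d (f : K) : kaehler := quotmod_pi _ (fgen K f).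
End Kaehler.

(* The k-th exterior power of M: the free module on k-tuples modulo
   multilinearity and the vanishing of tuples with a repeated entry. *)
Section ExteriorPower.
Variables (R : comPzRingType) (M : lmodType R) (k : nat).

Definition upd (u : 'I_k -> M) (i : 'I_k) (x : M) : 'I_k -> M :=
  fun j => if j == i then x else u j.

Definition extpow_rel : set (freemod R ('I_k -> M)) :=
  [set r |
     (exists (u : 'I_k -> M) i a x y, r = fgen R (upd u i (a *: x + y))
                            - a *: fgen R (upd u i x) - fgen R (upd u i y)) \/
     (exists u : 'I_k -> M, (exists i j, i <> j /\ u i = u j) /\ r = fgen R u)].

Definition extpow : Type := quotmod extpow_rel.
HB.instance Definition _ := GRing.Lmodule.on extpow.
Definition wedge (u : 'I_k -> M) : extpow := quotmod_pi _ (fgen R u).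
End ExteriorPower.

Section Forms.
Variables (A : comPzRingType) (n : nat).
Local Notation L := (iterL A n).

Definition Omega1_rel : set (kaehler L) :=
  range (fun f : L =>
    kaehler_d f - \sum_(i < n) pderiv i f *: kaehler_d (tvar A i)).
Definition Omega1 : Type := quotmod Omega1_rel.
HB.instance Definition _ := GRing.Lmodule.on Omega1.
Definition differential (f : L) : Omega1 := quotmod_pi _ (kaehler_d f).

Definition Omegan : Type := extpow Omega1 n.
HB.instance Definition _ := GRing.Lmodule.on Omegan.

Definition dt_form : Omegan := wedge (fun i => differential (tvar A i)).

(* Omegan is free of rank 1 with basis dt_form, so that formcoef w is the
   unique g with w = g dt_1 /\ ... /\ dt_n. *)
Definition formcoef (w : Omegan) : L := xget 0 [set g : L | w = g *: dt_form].

Definition residue (w : Omegan) : A := coef (formcoef w) (fun=> -1).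

Definition jacobian (phis : 'I_n -> L) : L :=
  \det (\matrix_(i < n, j < n) pderiv j (phis i)).

Definition mpow (phis : 'I_n -> L) (m : 'I_n -> int) : L :=
  \prod_(i < n) zexp (phis i) (m i).

(* The map f dt_1 /\ ... /\ dt_n |-> phi f . d(phi t_1) /\ ... /\ d(phi t_n). *)
Definition form_map (phi : L -> L) (w : Omegan) : Omegan :=
  phi (formcoef w) *: wedge (fun i => differential (phi (tvar A i))).

(* The adjoint of form_map phi for the residue pairing: adjoint phi f is the
   element g that represents the functional w |-> res (f phi(w)), that is,
   res (g w) = res (f phi(w)) for all w.  For phi a continuous morphism of
   A-algebras such a g exists and is unique; 0 is the default otherwise. *)
Definition adjoint (phi : L -> L) (f : L) : L :=
  xget 0 [set g : L | forall w : Omegan,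
                        residue (g *: w) = residue (f *: form_map phi w)].
End Forms.

(* Main.v *)
Require Import Defs.
From HB Require Import structures.
From mathcomp Require Import all_boot all_order all_algebra perm zify.
From mathcomp Require Import boolp classical_sets functions filter topology.
From mathcomp Require Import cardinality fsbigop.

Set Implicit Arguments.
Unset Strict Implicit.
Unset Printing Implicit Defensive.
Import Order.TTheory GRing.Theory Num.Theory.
Local Open Scope classical_set_scope.
Local Open Scope ring_scope.

(* The functional h |-> res (f phi(h) J dt_1 ... dt_n) is A-linear and vanishes
   on some U_lambda.  Such a functional F is residue pairing with a unique g: by
   induction on n, peel off the outermost variable and represent
   h' |-> F (h' t_n^k) for each k; these vanish for k > - lambda_n, so the
   representatives are the t_n-coefficients (in degree - 1 - k) of a Laurent
   series, and modulo U_lambda only finitely many k contribute to F h.  Hence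
   the adjoint exists, and its coefficient at t^l is read off by pairing it with
   t^(- l - 1), whose image under phi is the monomial phis^(- l - 1).
   The freeness of the top forms rests on the functional sending
   u_1 /\ ... /\ u_n to the determinant of the coordinates of the u_i, the
   coordinates of a 1-form being induced by the partial derivatives. *)

(** * Laurent series and their derivations *)

(** Finiteness of [P] matters: a sum with infinite support defaults to 0, while [h] may make that
    support finite. *)
Lemma raddf_fsbig (U V : zmodType) (h : {additive U -> V}) (I : choiceType)
    (P : set I) (F : I -> U) :
  finite_set P -> h (\sum_(i \in P) F i) = \sum_(i \in P) h (F i).
Proof.
move=> Pfin; rewrite [in RHS]fsbig_finite // -(raddf_sum h).
by congr (h _); exact: fsbig_finite.
Qed.

Section LaurentTheory.
Variable B : comPzRingType.
Implicit Types f g : laurent B.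

Lemma val_lmul f g N M (a b k : int) :
  (forall k, k < N -> val f k = 0) -> (forall k, k < M -> val g k = 0) ->
  a <= N -> k - M <= b ->
  val (f * g) k =
  \sum_(i \in [set i : int | a <= i <= b]) val f i * val g (k - i).
Proof. exact: lmul_funE. Qed.

Lemma val_lmul_single f k b j : val (f * single k b) j = val f (j - k) * b.
Proof.
rewrite /= /lmul_fun -(fsbig_widen [set (j - k)]) ?fsbig_set1 //=.
  by rewrite /single_fun ifT //; lia.
move=> i /= [_ /eqP ijk]; rewrite /single_fun ifF ?mulr0 //.
by apply/negbTE; apply: contra ijk => /eqP; lia.
Qed.

Lemma single_mul i (b : B) j c : single i b * single j c = single (i + j) (b * c).
Proof.
apply: laurentP => k; rewrite val_lmul_single /= /single_fun.
have -> : (k - j == i) = (k == i + j) by lia.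
by case: ifP; rewrite ?mul0r.
Qed.

Lemma singleB k (b c : B) : single k (b - c) = single k b - single k c.
Proof.
apply: laurentP => j.
transitivity (val (single k b) j - val (single k c) j) => //=.
by rewrite /single_fun; case: ifP; rewrite ?subr0.
Qed.

Lemma lderivM f g : lderiv (f * g) = f * lderiv g + g * lderiv f.
Proof.
have [[N fN] [M gM]] := (laurent_bound f, laurent_bound g).
have dgM k : k < M - 1 -> val (lderiv g) k = 0.
  by move=> kM; rewrite /= /lderiv_fun gM ?mul0rz //; lia.
apply: laurentP => k; rewrite laurentDE [g * _]mulrC.
rewrite (val_lmul (k := k) (b := k + 1 - M) fN dgM (lexx N)); last lia.
(* Shifting the index by one writes both sums in the terms f_i g_(k+1-i), with weights k + 1 - i and
   i that add up to k + 1. *)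
have -> : val (lderiv f * g) k = lmul_fun (fun i => val f i *~ i) (val g) (k + 1).
  rewrite [RHS](@reindex_fsbigT _ _ _ _ _ (fun i : int => i + 1)) /=; last first.
    by exists (fun i => i - 1) => i; lia.
  by apply: eq_fsbigr => i _; congr (_ * val g _); lia.
rewrite (@lmul_funE _ _ _ N M (k + 1) N (k + 1 - M)) //; last first.
  by move=> i /fN ->; rewrite mul0rz.
rewrite -fsbig_split /=; last exact: finite_itvz.
rewrite /lderiv_fun (@lmul_funE _ _ _ N M (k + 1) N (k + 1 - M)) //.
rewrite !fsbig_finite /=; try exact: finite_itvz.
rewrite mulrz_suml; apply: eq_bigr => i _.
rewrite (_ : k - i + 1 = k + 1 - i); last lia.
by rewrite mulrzAr mulrzAl -mulrzDr subrK.
Qed.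

End LaurentTheory.

Definition derivation (K : pzRingType) (D : K -> K) :=
  forall f g, D (f * g) = f * D g + g * D f.

Lemma derivation1 (K : pzRingType) (D : K -> K) : derivation D -> D 1 = 0.
Proof.
by move=> /(_ 1 1); rewrite !mul1r => /eqP; rewrite addrC -subr_eq subrr eq_sym => /eqP.
Qed.

Lemma val_lmap (B C : comPzRingType) (h : {additive B -> C}) f k :
  val (lmap h f) k = h (val f k).
Proof. by []. Qed.

Lemma lmap_derivation (B : comPzRingType) (D : {additive B -> B}) :
  derivation D -> derivation (lmap D).
Proof.
move=> DM f g; apply: laurentP => k.
have [[N fN] [M gM]] := (laurent_bound f, laurent_bound g).
have map0 (h : laurent B) P : (forall k, k < P -> val h k = 0) ->
  forall k, k < P -> val (lmap D h) k = 0.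
  by move=> hP j jP; rewrite /= hP // raddf0.
rewrite laurentDE [g * _]mulrC.
rewrite (val_lmul (k := k) (b := k - M) fN (map0 _ _ gM) (lexx N) (lexx _)).
rewrite (val_lmul (k := k) (b := k - M) (map0 _ _ fN) gM (lexx N) (lexx _)).
rewrite val_lmap.
rewrite (val_lmul (k := k) (b := k - M) fN gM (lexx N) (lexx _)).
rewrite -fsbig_split; last exact: finite_itvz.
rewrite raddf_fsbig; last exact: finite_itvz.
by apply: eq_fsbigr => i _; rewrite DM [_ * D (val f i)]mulrC.
Qed.

Section IteratedTheory.
Variable A : comPzRingType.

Lemma pderiv_derivation n (i : 'I_n) : derivation (@pderiv A n i).
Proof.
elim: n i => [[] //|n IH] i; rewrite /derivation /pderiv /=.
by case: unlift => [j|]; [apply: lmap_derivation; exact: IH|exact: lderivM].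
Qed.

Lemma pderiv_tvar n (i j : 'I_n) : pderiv i (tvar A j) = (i == j)%:R.
Proof.
elim: n i j => [[] //|n IH] i j; rewrite /pderiv /=.
case: (unliftP ord_max i) => [i'|] ->; case: (unliftP ord_max j) => [j'|] ->.
- rewrite (inj_eq lift_inj) -(rmorph_nat (@laurentC (iterL_rec A n))) -IH.
  apply: laurentP => k /=; rewrite /single_fun; case: ifP => // _.
  by rewrite raddf0.
(* An inner derivative acts on the single coefficient 1 of the outermost variable, and a derivation
   kills 1. *)
- rewrite lift_eqF; apply: laurentP => k /=; rewrite /single_fun; case: ifP.
    by move=> _; exact: (derivation1 (@pderiv_derivation n i')).
  by rewrite raddf0.
- rewrite eq_liftF; apply: laurentP => k /=.
  rewrite /lderiv_fun /= /single_fun; case: ifP => [/eqP -> //|_].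
  by rewrite mul0rz.
- rewrite eqxx; apply: laurentP => k /=; rewrite /lderiv_fun /= /single_fun.
  have -> : (k + 1 == 1) = (k == 0) by lia.
  by case: ifP => [/eqP -> //|_]; rewrite mul0rz.
Qed.

End IteratedTheory.

(** * Monomials and representation of continuous functionals *)

Section Zexp.

Lemma ring_invE (R : comPzRingType) (x y : R) : x * y = 1 -> ring_inv x = y.
Proof.
move=> xy; apply: xget_subset1 => //= z1 z2 /= xz1 xz2.
by rewrite -[z1]mulr1 -xz2 mulrA [z1 * x]mulrC xz1 mul1r.
Qed.

(** On a non-unit [ring_inv] defaults to 0, and [h] may send a non-unit to a unit; the inverse [y]
    of [x] rules this out. *)
Lemma rmorph_zexp (R S : comPzRingType) (h : {rmorphism R -> S}) x y k :
  x * y = 1 -> h (zexp x k) = zexp (h x) k.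
Proof.
move=> xy; have hxy : h x * h y = 1 by rewrite -rmorphM xy rmorph1.
by case: k => m; rewrite /zexp ?(ring_invE xy) ?(ring_invE hxy) rmorphXn.
Qed.

Lemma zexp_laurentX (B : comPzRingType) k :
  zexp (laurentX B) k = single k 1.
Proof.
have X_exp j m : single j (1 : B) ^+ m = single (j *+ m) 1.
  elim: m => [|m IH]; first by rewrite expr0 mulr0n.
  by rewrite exprS IH single_mul mulr1 mulrS.
case: k => m; rewrite /zexp; first by rewrite X_exp; congr single; lia.
rewrite (@ring_invE _ _ (single (-1) 1)); last by rewrite single_mul mulr1.
by rewrite X_exp; congr single; lia.
Qed.

End Zexp.

Section Iterated.
Variable A : comPzRingType.
Local Notation L := (iterL A).

(* The two sides differ by the comPzRingType structure on the carrier of the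
   coefficients, hence by the opaque proof of boundedness. *)
Lemma tvarS n (i : 'I_n.+1) :
  tvar A i = if unlift ord_max i is Some j
             then @laurentC (iterL_rec A n) (tvar A j)
             else laurentX (iterL_rec A n).
Proof. by rewrite /=; case: unlift => [j|//]; exact: laurentP. Qed.

Lemma tvar_invertible n (i : 'I_n) : exists y, tvar A i * y = 1.
Proof.
elim: n i => [[] //|n IH] i; rewrite tvarS.
case: unlift => [j|]; last by exists (single (-1) 1); rewrite single_mul mulr1.
have [y ty] := IH j; exists (@laurentC (iterL_rec A n) y).
transitivity (@laurentC (iterL_rec A n) (tvar A j * y)).
  by symmetry; exact: (laurentC_monoid (iterL_rec A n)).2.
by rewrite ty; exact: (laurentC_monoid (iterL_rec A n)).1.
Qed.

(** Splitting off the outermost variable mirrors the recursion that defines [coef]. *)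
Lemma mpow_tvarS n (m : 'I_n.+1 -> int) :
  mpow (@tvar A _) m =
  @single (iterL_rec A n) (m ord_max) (mpow (@tvar A _) (m \o lift ord_max)).
Proof.
pose B := iterL_rec A n.
rewrite -[m ord_max]add0r -[mpow _ _ in RHS]mulr1 -single_mul.
rewrite /mpow big_ord_recr; congr (_ * _); last first.
  by rewrite tvarS unlift_none zexp_laurentX.
rewrite [RHS](rmorph_prod (@laurentC B)); apply: eq_bigr => i _.
have -> : widen_ord (leqnSn n) i = lift ord_max i.
  by apply: val_inj; rewrite /= /bump leqNgt ltn_ord.
rewrite tvarS liftK; have [y ty] := tvar_invertible i.
exact/esym/(rmorph_zexp (@laurentC B) _ ty).
Qed.

Lemma rmorph_mpow_tvar n (R : comPzRingType) (h : {rmorphism L n -> R}) m :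
  h (mpow (@tvar A _) m) = \prod_(i < n) zexp (h (tvar A i)) (m i).
Proof.
rewrite rmorph_prod; apply: eq_bigr => i _.
by have [y ty] := tvar_invertible i; rewrite (rmorph_zexp h _ ty).
Qed.

Lemma coefS n (f : L n.+1) l :
  coef f l = @coef A n (val f (l ord_max)) (l \o lift ord_max).
Proof. by []. Qed.

Lemma coef_mul_mpow n (g : L n) (m l : 'I_n -> int) :
  coef (g * mpow (@tvar A _) m) l = coef g (fun i => l i - m i).
Proof.
elim: n g m l => [|n IH] g m l; first by rewrite /mpow big_ord0 mulr1.
by rewrite mpow_tvarS !coefS [val _ _](@val_lmul_single (iterL_rec A n)) IH.
Qed.

(** [coef] with the exponent first, a form that can carry the structure of a linear functional. *)
Definition coefl n (l : 'I_n -> int) (f : L n) : A := coef f l.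
Fact coefl_additive n l : zmod_morphism (@coefl n l).
Proof. by move=> f g; exact: Defs.coefB. Qed.
HB.instance Definition _ n l :=
  GRing.isZmodMorphism.Build (L n) A (@coefl n l) (coefl_additive l).

Fact coefl_scalable n l : scalable_for *%R (@coefl n l).
Proof.
rewrite /coefl => a f; elim: n l f => [//|n IH] l f.
rewrite !coefS -IH; congr coef.
(* In the outermost variable a scalar acts as a series concentrated in degree 0. *)
have -> : a *: f = f * @single (iterL_rec A n) 0 (iterC A n a) by exact: mulrC.
by rewrite [LHS](@val_lmul_single (iterL_rec A n)) subr0 mulrC.
Qed.
HB.instance Definition _ n l :=
  GRing.isScalable.Build A (L n) A *%R (@coefl n l) (coefl_scalable l).

Definition singleL n k (f : L n) : L n.+1 := @single (iterL_rec A n) k f.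
Fact singleL_additive n k : zmod_morphism (@singleL n k).
Proof. by move=> f g; exact: singleB. Qed.
HB.instance Definition _ n k :=
  GRing.isZmodMorphism.Build (L n) (L n.+1) (@singleL n k) (singleL_additive k).
Fact singleL_scalable n k : scalable (@singleL n k).
Proof.
move=> a f; rewrite /( *:%R) /= /scaleL /singleL /=.
by rewrite [RHS]single_mul add0r.
Qed.
HB.instance Definition _ n k :=
  GRing.isScalable.Build A (L n) (L n.+1) *:%R (@singleL n k) (singleL_scalable k).

(** * Neighborhoods of zero and the functionals that vanish on one *)

Lemma UlambdaS n (lam : Lambda n.+1) (h : L n.+1) :
  Ulambda lam h <-> forall k, lam.2 <= k -> Ulambda (lam.1 k) (val h (- k) : L n).
Proof.
split=> [/UlambdaP Uh k lamk|Uh]; apply/UlambdaP.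
  move=> l lP.
  pose l1 (j : 'I_n.+1) := if unlift ord_max j is Some j' then l j' else k.
  have l1M : l1 ord_max = k by rewrite /l1 unlift_none.
  have l1l : l1 \o lift ord_max = l by apply/funext => j; rewrite /l1 /= liftK.
  have := Uh l1; rewrite /= l1M l1l => /(_ (conj lamk lP)).
  rewrite -[(- l1) ord_max]/(- l1 ord_max) l1M => <-.
  by congr coef; rewrite -l1l.
by move=> l [/= lk lP]; move/UlambdaP: (Uh _ lk) => /(_ _ lP).
Qed.

(** The outermost coefficient of degree k of [c * h] is a finite sum of terms c_i h_(k-i) with i >=
    N, and induction supplies a parameter [mu i] for each term. *)
Lemma coef_mul_vanish n (c : L n) l :
  exists lam, forall h, Ulambda lam h -> coef (c * h) l = 0.
Proof.
elim: n c l => [|n IH] c l.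
  exists tt => h /UlambdaP Uh.
  by have := Uh l I; rewrite /= => ->; rewrite mulr0.
have [N cN] := laurent_bound c.
have /choice[mu muP] : forall i, exists mu, forall h : L n, Ulambda mu h ->
    coef ((val c i : L n) * h) (l \o lift ord_max) = 0 by move=> i; exact: IH.
pose k := l ord_max.
(* A parameter at index j constrains degree - j, and c_i meets [h] in degree k - i; hence i = j + k
   and j >= N - k. *)
exists (fun j => mu (j + k), N - k) => h /UlambdaS Uh.
have [M hM] := laurent_bound h.
rewrite coefS [val _ _](@val_lmul (iterL_rec A n) _ _ _ _ _ _ k cN hM (lexx _) (lexx _)).
rewrite -[LHS]/(coefl (l \o lift ord_max) _) raddf_fsbig; last exact: finite_itvz.
apply: fsbig1 => i /= /andP[Ni _]; apply: muP.
have /= := Uh (i - k); rewrite subrK opprB; apply; lia.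
Qed.

Definition coefz (B : comPzRingType) (k : int) (f : laurent B) : B := val f k.
Fact coefz_additive (B : comPzRingType) k : zmod_morphism (@coefz B k).
Proof. by []. Qed.
HB.instance Definition _ (B : comPzRingType) k :=
  GRing.isZmodMorphism.Build (laurent B) B (@coefz B k) (coefz_additive k).

Lemma val_fsbig (B : comPzRingType) (I : choiceType) (P : set I)
    (F : I -> laurent B) k :
  finite_set P -> val (\sum_(i \in P) F i) k = \sum_(i \in P) val (F i) k.
Proof. exact: (raddf_fsbig (coefz k)). Qed.

Lemma residue_representation n (F : {scalar L n}) :
  (exists lam, forall h, Ulambda lam h -> F h = 0) ->
  exists g, forall h, F h = coef (g * h) (fun=> -1).
Proof.
elim: n F => [|n IH] F [lam Flam].
  exists (F 1) => h /=; rewrite [RHS]mulrC -scalarZ.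
  by congr (F _); rewrite /( *:%R) /= /scaleL mulr1.
(* The vanishing for k > - lam.2 is recorded with the choice because it makes the assembled series
   bounded below. *)
have /choice[g gP] : forall k, exists g : L n,
    (- lam.2 < k -> g = 0) /\
    forall h, F (singleL k h) = coef (g * h) (fun=> -1).
  move=> k; have [kl|kl] := ltP (- lam.2) k.
    exists 0; split=> // h; rewrite mul0r Flam.
      by rewrite -[RHS]/(coefl _ _) raddf0.
    apply/UlambdaS => j lj; rewrite /= /single_fun ifF; last lia.
    exact: Ulambda0.
  have [|g gP] := IH (F \o singleL k).
    (* Degree k is governed by the index - k of [lam]. *)
    exists (lam.1 (- k)) => h Uh; apply: Flam; apply/UlambdaS => j lj /=.
    rewrite /single_fun; case: eqP => [jk|_]; last exact: Ulambda0.
    by rewrite -(opprK j) jk.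
  by exists g; split=> [|h]; [lia|exact: gP].
(* Residue pairing matches degree k of [h] with degree - 1 - k of the representing series. *)
have gb : (fun j => g (- 1 - j)) \in @bounded_below (iterL_rec A n).
  apply/asboolP; exists (lam.2 - 1) => j jl.
  by apply: (gP _).1; lia.
exists (mkLaurent gb) => h; have [N hN] := laurent_bound h.
(* Below N the series [h] vanishes; above - lam.2 membership in U_lambda imposes nothing, so those
   degrees do not affect [F]. *)
pose D := [set i : int | N <= i <= - lam.2].
have Dfin : finite_set D by exact: finite_itvz.
transitivity (F (\sum_(k \in D) singleL k (val h k))).
  apply/eqP; rewrite -subr_eq0 -raddfB; apply/eqP/Flam/UlambdaS => k lk.
  suff -> : val (h - \sum_(k \in D) singleL k (val h k)) (- k) = 0.
    exact: Ulambda0.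
  apply/eqP; rewrite subr_eq0; apply/eqP.
  rewrite [RHS](@val_fsbig (iterL_rec A n)) //.
  have [kN|kN] := ltP (- k) N.
        rewrite hN // fsbig1 // => j /= /andP[Nj _].
    by rewrite /single_fun ifF //; lia.
  rewrite -(fsbig_widen [set - k]) ?fsbig_set1 /=.
  - by rewrite /single_fun eqxx.
  - by move=> _ -> /=; rewrite /D /=; lia.
  - by move=> j /= [_ /eqP jk]; rewrite /single_fun eq_sym (negPf jk).
transitivity (\sum_(k \in D) coef (g k * val h k) (fun=> -1)).
  by rewrite raddf_fsbig //; apply: eq_fsbigr => k _; exact: (gP k).2.
have GB j : j < lam.2 - 1 -> g (- 1 - j) = 0 by move=> jl; apply: (gP _).1; lia.
rewrite coefS [val _ _](@val_lmul (iterL_rec A n) (mkLaurent gb) h _ _ _ _ (-1)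
  GB hN (lexx _) (lexx _)).
rewrite -[RHS]/(coefl ((fun=> -1) \o lift ord_max) _) raddf_fsbig; last first.
  exact: finite_itvz.
(* The substitution k |-> - 1 - k turns degrees of the representing series into degrees of [h]. *)
rewrite [RHS](@reindex_fsbig _ _ _ _ _ (fun k => - 1 - k) D).
  apply: eq_fsbigr => k _; rewrite /coefl /=.
  by rewrite (_ : - 1 - (- 1 - k) = k) //; lia.
split=> [k /= | k1 k2 _ _ |k /= kP]; rewrite /D /=; [lia|lia|].
by exists (- 1 - k) => /=; lia.
Qed.

End Iterated.

(** * Free modules, quotients and exterior powers *)

Section FreeModuleTheory.
Variables (R : pzRingType) (X : choiceType).
Local Notation M := (freemod R X).

Definition free_coord (x : X) (u : M) : R := val u x.
Fact free_coord_additive x : zmod_morphism (free_coord x).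
Proof. by []. Qed.
HB.instance Definition _ x :=
  GRing.isZmodMorphism.Build M R (free_coord x) (free_coord_additive x).

Lemma free_finite (u : M) : finite_set [set x | free_coord x u <> 0].
Proof. exact/asboolP/(valP u). Qed.

(** Every element is the finite combination of generators given by its coordinates. *)
Lemma freemod_ind (P : M -> Prop) :
  P 0 -> (forall a u v, P u -> P v -> P (a *: u + v)) ->
  (forall x, P (fgen R x)) -> forall u, P u.
Proof.
move=> P0 PD Pgen u; have fu := free_finite u.
suff -> : u = \sum_(x \in [set x | free_coord x u <> 0])
    free_coord x u *: fgen R x.
  rewrite fsbig_finite //.
  apply: (big_ind (P : M -> Prop)) => // [v w Pv Pw|x _].
    by rewrite -[v]scale1r; exact: PD.
  by rewrite -[_ *: _]addr0; exact: PD.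
apply/val_inj/funext => y; rewrite -![val _ y]/(free_coord y _).
rewrite raddf_fsbig //.
have coordE x : free_coord y (free_coord x u *: fgen R x)
    = if y == x then free_coord y u else 0.
  rewrite [LHS]/(free_coord x u * (y == x)%:R).
  by case: eqP => [->|_]; [exact: mulr1|exact: mulr0].
rewrite (eq_fsbigr (fun x => if y == x then free_coord y u else 0)); last first.
  by move=> x _; exact: coordE.
have [u0|u0] := pselect (free_coord y u = 0).
  by rewrite u0 fsbig1 // => x _; case: ifP.
rewrite -(fsbig_widen [set y]) ?fsbig_set1 ?eqxx //=.
  by move=> _ ->.
by move=> x /= [_ /eqP xy]; rewrite eq_sym (negPf xy).
Qed.

(** The linear extension of [w] from the generators; only the finite support of [u] contributes to
    the sum. *)
Definition free_lift (w : X -> R) (u : M) : R :=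
  \sum_(x \in [set: X]) free_coord x u * w x.

(** Allows [u], [v] and [a *: u + v] to be summed over one common finite set. *)
Lemma free_liftE w (E : set X) u : [set x | free_coord x u <> 0] `<=` E ->
  free_lift w u = \sum_(x \in E) free_coord x u * w x.
Proof.
move=> uE; apply/esym/fsbig_widen => // x /= [_ xE].
have [->|u0] := pselect (free_coord x u = 0); first by rewrite mul0r.
by case: xE; exact: uE.
Qed.

Fact free_lift_linear w : scalar (free_lift w).
Proof.
move=> a u v; pose E := [set x | free_coord x u <> 0] `|` [set x | free_coord x v <> 0].
have fE : finite_set E by rewrite finite_setU; split; exact: free_finite.
have coordE x : free_coord x (a *: u + v) = a * free_coord x u + free_coord x v.
  by [].
rewrite (@free_liftE _ E (a *: u + v)); last first.
  move=> x /=; rewrite coordE => H; have [u0|] := pselect (free_coord x u = 0); last by left.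
  by right => v0; apply: H; rewrite u0 v0 mulr0 addr0.
rewrite (@free_liftE _ E u); last by move=> x; left.
rewrite (@free_liftE _ E v); last by move=> x; right.
rewrite !fsbig_finite // [a * _]mulr_sumr -big_split; apply: eq_bigr => x _.
by rewrite coordE mulrDl mulrA.
Qed.
HB.instance Definition _ w :=
  GRing.isLinear.Build R M R *%R (free_lift w) (free_lift_linear w).

Lemma free_lift_gen w x : free_lift w (fgen R x) = w x.
Proof.
rewrite (@free_liftE _ [set x]) => [|y /=].
  by rewrite fsbig_set1 /free_coord /= eqxx mul1r.
by rewrite /free_coord /=; case: eqP.
Qed.

End FreeModuleTheory.

Section QuotientModuleTheory.
Variables (R : pzRingType) (V : lmodType R) (G : set V).

Lemma quotmod_pi_linear : linear (quotmod_pi G).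
Proof.
by move=> a u v; rewrite quotmod_piD; congr (_ + _); rewrite -quotmod_scaleE.
Qed.

Lemma quotmod_pi_eq0 v : G v -> quotmod_pi G v = 0.
Proof.
move=> Gv; rewrite -(subrr (quotmod_pi G 0)) -quotmod_piB subr0.
by apply/quotmod_eq; rewrite subr0; apply/asboolP => S _; apply.
Qed.

(** The kernel of [T] is a submodule containing [G], hence the submodule that [G] generates; so the
    value of [T] does not depend on the representative chosen by [r]. *)
Lemma quotmod_functional (T : {scalar V}) : (forall g, G g -> T g = 0) ->
  exists T' : {scalar quotmod G}, forall v, T' (quotmod_pi G v) = T v.
Proof.
move=> T0; have /choice[r rP] := @quotmod_surj _ _ G.
have TE v : T (r (quotmod_pi G v)) = T v.
  apply/eqP; rewrite -subr_eq0 -raddfB; apply/eqP.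
  have /quotmod_eq/asboolP := rP (quotmod_pi G v).
  move=> /(_ [pred v | T v == 0]) H; apply/eqP/H => [|g Gg]; last first.
    by rewrite inE /= T0.
  split=> [|a x y]; rewrite !inE ?raddf0 // => /eqP Tx /eqP Ty.
  by rewrite linearP Tx Ty /= mulr0 addr0.
have Tlin : scalar (T \o r).
  move=> a x y; have [[u <-] [v <-]] := (quotmod_surj x, quotmod_surj y).
  by rewrite -quotmod_pi_linear /= !TE linearP.
pose T' : {scalar quotmod G} := HB.pack (T \o r)
  (GRing.isLinear.Build R (quotmod G) R *%R (T \o r) Tlin).
by exists T'.
Qed.

End QuotientModuleTheory.

(** * Exterior powers: alternation, spanning and determinants *)

Section Wedge.
Variables (R : comPzRingType) (M : lmodType R) (k : nat).
Implicit Types (u : 'I_k -> M) (i j : 'I_k) (x y : M).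

Lemma upd_id u i : upd u i (u i) = u.
Proof. by apply/funext => j; rewrite /upd; case: eqP => [->|]. Qed.

Lemma updC u i j x y : i != j -> upd (upd u i x) j y = upd (upd u j y) i x.
Proof.
move=> ij; apply/funext => l; rewrite /upd.
by have [->|//] := eqVneq l j; rewrite eq_sym (negPf ij).
Qed.

Lemma wedgeP u i a x y :
  wedge (upd u i (a *: x + y)) = a *: wedge (upd u i x) + wedge (upd u i y).
Proof.
apply/eqP; rewrite /wedge -quotmod_pi_linear -subr_eq0 -quotmod_piB.
apply/eqP/quotmod_pi_eq0; left; exists u, i, a, x, y.
by rewrite opprD addrA.
Qed.

Lemma wedge_alt u i j : i != j -> u i = u j -> wedge u = 0.
Proof.
move=> /eqP ij uij; apply: quotmod_pi_eq0; right; exists u.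
by split=> //; exists i, j.
Qed.

Lemma wedge_updD u i x y :
  wedge (upd u i (x + y)) = wedge (upd u i x) + wedge (upd u i y).
Proof. by rewrite -[x in LHS]scale1r wedgeP scale1r. Qed.

Lemma wedge_upd0 u i : wedge (upd u i 0) = 0.
Proof. by apply: (addrI (wedge (upd u i 0))); rewrite -wedge_updD !addr0. Qed.

Lemma wedge_upd_sum u i (I : Type) (r : seq I) (a : I -> R) (x : I -> M) :
  wedge (upd u i (\sum_(l <- r) a l *: x l)) =
  \sum_(l <- r) a l *: wedge (upd u i (x l)).
Proof.
elim: r => [|l r IH]; first by rewrite !big_nil wedge_upd0.
by rewrite !big_cons wedgeP IH.
Qed.

(** Polarization: expanding the vanishing wedge with u_i + u_j in both places leaves only the two
    mixed terms. *)
Lemma wedge_tperm u i j : i != j -> wedge (u \o tperm i j) = - wedge u.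
Proof.
move=> ij; pose W x y := wedge (upd (upd u i x) j y).
have Wxx x : W x x = 0.
  by apply: (wedge_alt ij); rewrite /upd !eqxx (negPf ij).
have WDl x x' y : W (x + x') y = W x y + W x' y.
  by rewrite /W !(updC _ _ _ ij) wedge_updD.
have WDr x y y' : W x (y + y') = W x y + W x y' by exact: wedge_updD.
have := Wxx (u i + u j); rewrite WDl !WDr !Wxx add0r addr0.
rewrite {1}/W !upd_id => /eqP; rewrite addr_eq0 => /eqP ->.
rewrite opprK; congr wedge; apply/funext => l; rewrite /upd /=.
case: tpermP => [->|->|/eqP/negPf li /eqP/negPf lj]; rewrite ?eqxx //.
  by rewrite (negPf ij).
by rewrite li lj.
Qed.

(** Each transposition in a factorization of [s] contributes a factor -1. *)
Lemma wedge_perm u (s : {perm 'I_k}) : exists e, wedge (u \o s) = e *: wedge u.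
Proof.
have [ts -> dts] := prod_tpermP s.
elim: ts u dts => [|[i j] ts IH] u /=.
  by exists 1; rewrite big_nil scale1r; congr wedge; apply/funext => l /=; rewrite perm1.
move=> /andP[/= ij /(IH u)[e eP]]; exists (- e).
rewrite big_cons scaleNr -eP -(wedge_tperm _ ij); congr wedge.
by apply/funext => l /=; rewrite permM.
Qed.

(** Entries are expanded one at a time in terms of [e]. Once all of them are among the [e i], the
    wedge vanishes if one repeats, and otherwise is a permutation of [wedge e]. *)
Lemma extpow_span (e : 'I_k -> M) :
  (forall x, exists a : 'I_k -> R, x = \sum_i a i *: e i) ->
  forall w : extpow M k, exists g, w = g *: wedge e.
Proof.
move=> span.
have wedge_e (s : 'I_k -> 'I_k) : exists g, wedge (e \o s) = g *: wedge e.
  have [/injectiveP sI|/injectivePn[i [j ij sij]]] := boolP (injectiveb s).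
    have [g gP] := wedge_perm e (perm sI); exists g; rewrite -gP; congr wedge.
    by apply/funext => i /=; rewrite permE.
  by exists 0; rewrite scale0r; apply: (wedge_alt ij); rewrite /= sij.
(* Entries from position m on are already among the [e j]; expanding the entry just before them
   lowers m, down to 0. *)
have wedge_span m u : (forall i : 'I_k, (m <= i)%N -> exists j, u i = e j) ->
    exists g, wedge u = g *: wedge e.
  elim: m u => [|m IH] u um.
    have /choice[s sP] : forall i, exists j, u i = e j by move=> i; exact: um.
    have [g gP] := wedge_e s; exists g; rewrite -gP; congr wedge.
    by apply/funext => i /=; rewrite sP.
  have [km|mk] := leqP k m.
    by apply: IH => i mi; have := ltn_ord i; rewrite ltnNge (leq_trans km mi).
  pose i0 := Ordinal mk; have [a aP] := span (u i0).
  have /choice[g gP] : forall j, exists g, wedge (upd u i0 (e j)) = g *: wedge e.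
    move=> j; apply: IH => i mi; rewrite /upd; case: eqP => [_|i0i].
      by exists j.
    apply: um; rewrite ltn_neqAle mi andbT eq_sym; apply/eqP => im.
    by apply: i0i; exact: val_inj.
  exists (\sum_j a j * g j); rewrite -(upd_id u i0) aP wedge_upd_sum scaler_suml.
  by apply: eq_bigr => j _; rewrite gP scalerA.
move=> w; have [v <-] := quotmod_surj w.
elim/freemod_ind: v => [|a u v [g gP] [h hP]|u].
- exists 0; rewrite scale0r.
  by rewrite -(subrr (0 : freemod R _)) quotmod_piB subrr.
- by exists (a * g + h); rewrite quotmod_pi_linear gP hP scalerDl scalerA.
(* At m = k the condition on the entries is vacuous. *)
- by apply: (wedge_span k) => i; rewrite leqNgt ltn_ord.
Qed.

(** The determinant is multilinear and alternating in its rows, so its linear extension to the free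
    module kills [extpow_rel]. *)
Lemma extpow_det (c : 'I_k -> {scalar M}) :
  exists D : {scalar extpow M k},
    forall u, D (wedge u) = \det (\matrix_(i, j) c j (u i)).
Proof.
pose w u := \det (\matrix_(i, j) c j (u i)).
have [|D DP] := @quotmod_functional _ _ (@extpow_rel R M k) (free_lift w).
  move=> _ [[u [i [a [x [y ->]]]]]|[u [[i [j [/eqP ij uij]]] ->]]].
    rewrite !linearB linearZ /= !free_lift_gen -addrA -opprD.
    apply/eqP; rewrite subr_eq0; apply/eqP; rewrite -[w (upd u i y)]mul1r.
    apply: (determinant_multilinear (i0 := i)).
    - by apply/rowP => j; rewrite !mxE /upd eqxx linearP mul1r.
    - apply/matrixP => i' j; rewrite !mxE /upd.
      by rewrite eq_sym (negPf (neq_lift _ _)).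
    - apply/matrixP => i' j; rewrite !mxE /upd.
      by rewrite eq_sym (negPf (neq_lift _ _)).
  apply: (etrans (free_lift_gen _ _)); apply: (determinant_alternate ij) => l.
  by rewrite !mxE uij.
exists D => u; exact/(etrans (DP _))/free_lift_gen.
Qed.

End Wedge.

(** * Differential forms *)

Section FormsTheory.
Variables (A : comPzRingType) (n : nat).
Local Notation L := (iterL A n).

(** The Leibniz rule carries [pderiv i] down to Kaehler differentials; there it kills [Omega1_rel]
    because the partial derivatives of the variables form the identity matrix. *)
Lemma Omega1_coord (i : 'I_n) :
  exists c : {scalar Omega1 A n}, forall f, c (differential f) = pderiv i f.
Proof.
have [|d dP] := @quotmod_functional _ _ (@kaehler_rel L) (free_lift (@pderiv A n i)).
  move=> _ [f [g [->|->]]].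
    rewrite !linearB /= !free_lift_gen [pderiv i (f + g)]raddfD.
    by rewrite -addrA -opprD subrr.
  rewrite !linearB !linearZ /= !free_lift_gen pderiv_derivation.
  by rewrite -addrA -opprD subrr.
have dE f : d (kaehler_d f) = pderiv i f by rewrite dP; exact: free_lift_gen.
have [|c cP] := @quotmod_functional _ _ (@Omega1_rel A n) d.
  move=> _ [f _ <-]; rewrite linearB raddf_sum dE (bigD1 i) //= big1 => [|j ji].
    by rewrite linearZ /= dE pderiv_tvar eqxx mulr1 addr0 subrr.
  by rewrite linearZ /= dE pderiv_tvar eq_sym (negPf ji) mulr0.
by exists c => f; rewrite cP dE.
Qed.

Lemma differentialE (f : L) :
  differential f = \sum_i pderiv i f *: differential (tvar A i).
Proof.
pose S := \sum_(i < n) pderiv i f *: kaehler_d (tvar A i).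
have -> : \sum_i pderiv i f *: differential (tvar A i) = quotmod_pi (@Omega1_rel A n) S.
  rewrite /S; elim/big_rec2: _ => [|i x y _ ->].
    by rewrite -(subrr (0 : kaehler L)) quotmod_piB subrr.
  by rewrite quotmod_pi_linear.
apply/eqP; rewrite -subr_eq0 -quotmod_piB; apply/eqP/quotmod_pi_eq0.
by exists f.
Qed.

Lemma Omega1_span (x : Omega1 A n) :
  exists a : 'I_n -> L, x = \sum_i a i *: differential (tvar A i).
Proof.
have [y <-] := quotmod_surj x; have [v <-] := quotmod_surj y.
elim/freemod_ind: v => [|b u v [a aP] [c cP]|f].
- exists (fun=> 0); rewrite big1 => [|i _]; last by rewrite scale0r.
  rewrite -(subrr (0 : freemod _ _)) quotmod_piB subrr.
  by rewrite -(subrr (0 : kaehler L)) quotmod_piB subrr.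
- exists (fun i => b * a i + c i); rewrite !quotmod_pi_linear aP cP.
  rewrite scaler_sumr -big_split; apply: eq_bigr => i _.
  by rewrite scalerDl scalerA.
- by exists (fun i => pderiv i f); exact: differentialE.
Qed.

Lemma Omegan_coord : exists D : {scalar Omegan A n}, forall phis : 'I_n -> L,
  D (wedge (fun i => differential (phis i))) = jacobian phis.
Proof.
have /choice[c cP] := Omega1_coord.
have [D DP] := extpow_det c; exists D => phis; rewrite DP; congr (\det _).
by apply/matrixP => i j; rewrite !mxE cP.
Qed.

Lemma jacobian_tvar : jacobian (@tvar A n) = 1.
Proof.
rewrite -(det1 L n); congr (\det _); apply/matrixP => i j.
by rewrite !mxE pderiv_tvar eq_sym.
Qed.

Lemma Omegan_span (w : Omegan A n) : exists g : L, w = g *: dt_form A n.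
Proof. by apply: extpow_span; exact: Omega1_span. Qed.

(** The functional [D] is left inverse to g |-> g dt_1 ... dt_n, so [xget] has exactly one
    candidate. *)
Lemma formcoef_scale (g : L) : formcoef (g *: dt_form A n) = g.
Proof.
have [D DP] := Omegan_coord.
have Ddt h : D (h *: dt_form A n) = h.
  by rewrite linearZ /= DP jacobian_tvar mulr1.
apply: xget_subset1 => //= g1 g2 /= g1P g2P.
by rewrite -[g1]Ddt -[g2]Ddt -g1P -g2P.
Qed.

Lemma residue_scale (g : L) : residue (g *: dt_form A n) = coef g (fun=> -1).
Proof. by rewrite /residue formcoef_scale. Qed.

(** Spanning provides some scalar, and applying [D] identifies it as the Jacobian. *)
Lemma wedge_differential (phis : 'I_n -> L) :
  wedge (fun i => differential (phis i)) = jacobian phis *: dt_form A n.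
Proof.
have [g gP] := Omegan_span (wedge (fun i => differential (phis i))).
have [D DP] := Omegan_coord; rewrite gP; congr (_ *: _).
by rewrite -DP gP linearZ /= DP jacobian_tvar mulr1.
Qed.

End FormsTheory.

(** * The adjoint of a continuous homomorphism and its coefficients *)

Theorem mainTheorem10 (A : comPzRingType) (n : nat)
    (phi : {rmorphism iterL A n -> iterL A n}) :
  (1 <= n)%N ->
  scalable phi ->
  continuous phi ->
  forall f : iterL A n,
    let phis : 'I_n -> iterL A n := fun i => phi (tvar A i) in
    has_expansion (adjoint phi f)
      (fun l => residue
         ((f * mpow phis (fun i => - l i - 1) * jacobian phis) *: dt_form A n)).
Proof.
move=> _ phiZ phiC f phis.
(* As phi(h dt_1 ... dt_n) is phi(h) J dt_1 ... dt_n, absorbing J into [c] leaves the functional h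
   |-> res (c phi(h) dt_1 ... dt_n) to represent. *)
pose c := f * jacobian phis.
pose F0 h := coefl (fun=> -1) (c * phi h).
have F0_linear : scalar F0.
  move=> a g h; rewrite /F0 rmorphD phiZ mulrDr raddfD -linearZ.
  by congr (coefl _ _ + _); exact: mulrCA.
pose F : {scalar iterL A n} := HB.pack F0
  (GRing.isLinear.Build A (iterL A n) A *%R F0 F0_linear).
(* Multiplication by [c] supplies U_lam, and continuity of [phi] at 0 supplies a U_mu that [phi]
   sends into it. *)
have [lam lamP] := coef_mul_vanish c (fun=> -1).
have [|g gP] := @residue_representation _ _ F.
  have [|mu _ muP] := phiC 0 [set h | Ulambda lam (h - phi 0)].
    by exists lam.
  exists mu => h Uh; apply: lamP; have := muP h.
  by rewrite /= rmorph0 !subr0; apply.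
have coef_adjoint h : coef (adjoint phi f * h) (fun=> -1) = coef (c * phi h) (fun=> -1).
  have form_mapE h1 : form_map phi (h1 *: dt_form A n) =
      (phi h1 * jacobian phis) *: dt_form A n.
    by rewrite /form_map formcoef_scale wedge_differential scalerA.
  (* The representing [g] makes this set nonempty, so [adjoint] satisfies its defining equation
     instead of taking the default 0. *)
  have : [set g : iterL A n | forall w,
      residue (g *: w) = residue (f *: form_map phi w)] (adjoint phi f).
    apply: xgetPex; exists g => w; have [h1 ->] := Omegan_span w.
    rewrite form_mapE !scalerA !residue_scale -gP.
    by rewrite /= /F0 /coefl /c -mulrA [jacobian _ * _]mulrC.
  move=> /(_ (h *: dt_form A n)); rewrite form_mapE !scalerA !residue_scale => ->.
  by rewrite /c -mulrA [jacobian _ * _]mulrC.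
move=> l; rewrite residue_scale.
(* Multiplying by t^(- l - 1) moves the coefficient at l to the exponent -1. *)
have := coef_adjoint (mpow (@tvar A n) (fun i => - l i - 1)).
rewrite coef_mul_mpow rmorph_mpow_tvar.
have -> : (fun i => -1 - (- l i - 1)) = l by apply/funext => i; lia.
by move=> ->; rewrite /c mulrAC.
Qed.
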